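(* Let $\Gamma$, $\Sigma$ and $\Delta$ be graphs with the following properties. (i) $\Gamma$ is locally $\Sigma$, and every $\mu$-graph of $\Sigma$ is isomorphic to $\Delta$. (ii) $\Sigma$ is strongly regular with $\mu(\Sigma)>0$. (iii) $\Delta$ is regular with diameter $2$ and $k_2(\Delta)=1$. Then $\Gamma$ has the unique $x$ property.
   Context: All graphs are undirected and simple with non-empty vertex set $V\Gamma$. For $u\in V\Gamma$, $\Gamma_i(u)$ is the set of vertices at distance $i$ from $u$, and $\Gamma(u)=\Gamma_1(u)$. The notation $k_i(\Delta)$ denotes $|\Delta_i(y)|$ and indicates the assumption that this number does not depend on the choice of vertex $y$ of $\Delta$. A graph $\Gamma$ is locally $\Sigma$ if the neighbourhood of every vertex of $\Gamma$ is non-empty and induces a graph isomorphic to $\Sigma$. A strongly regular graph with parameters $(v,k,\lambda,\mu)$ is a finite graph of order $v$, regular of valency $k$ with $0<k<v-1$, in which any two adjacent vertices have $\lambda=\lambda(\Sigma)$ common neighbours and any two distinct non-adjacent vertices have $\mu=\mu(\Sigma)$ common neighbours. A $\mu$-graph of $\Sigma$ is a subgraph induced by $\Sigma(u)\cap\Sigma(w)$ for some vertices $u,w$ at distance two in $\Sigma$. A non-complete graph $\Gamma$ has the unique $x$ property if for some $u\in V\Gamma$, $v\in\Gamma(u)$ and $w\in\Gamma_2(u)\cap\Gamma(v)$, there exists a unique $x\in\Gamma(u)\cap\Gamma_2(v)$ such that $\Gamma(u)\cap\Gamma(v)\cap\Gamma(w)=\Gamma(u)\cap\Gamma(v)\cap\Gamma(x)$.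 *)

(* Defs.v *)
From mathcomp Require Import all_boot.
From mathcomp Require Import boolp classical_sets functions cardinality.

Set Implicit Arguments.
Unset Strict Implicit.
Unset Printing Implicit Defensive.

Local Open Scope classical_set_scope.
Local Open Scope card_scope.

(* Graphs may be infinite and disconnected; cardinalities are expressed with
   [A #= `I_n], i.e. A is in bijection with {0, ..., n-1}. *)
Record sgraph : Type := SGraph {
  vertex :> Type;
  adj : rel vertex;
  adj_sym : symmetric adj;
  adj_irrefl : irreflexive adj;
  vertex_inhabited : inhabited vertex }.

Arguments adj {s}.

Section Graph.
Variable G : sgraph.
Implicit Types (u v x y : G) (i k n : nat) (A : set G).

Definition walk n x y : Prop :=
  exists p : seq G, [/\ path adj x p, last x p = y & size p = n].

Definition sphere i u : set G :=
  [set v | walk i u v /\ forall j, (j < i)%N -> ~ walk j u v].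

Definition nbhd u : set G := [set v | adj u v].

Definition complete : Prop := forall x y, x <> y -> adj x y.

(* k_i(G) is defined and equal to n *)
Definition has_k i n : Prop := forall y, sphere i y #= `I_n.

Definition valency k : Prop := forall y, nbhd y #= `I_k.

Definition regular : Prop := exists k, valency k.

Definition has_diameter n : Prop :=
  (forall x y, exists2 i, (i <= n)%N & sphere i x y)
  /\ (exists x y, sphere n x y).

Definition strongly_regular (v k lambda mu : nat) : Prop :=
  [/\ [set: G] #= `I_v,
      valency k,
      (0 < k < v - 1)%N,
      (forall x y, adj x y -> nbhd x `&` nbhd y #= `I_lambda)
    & (forall x y, x <> y -> ~~ adj x y -> nbhd x `&` nbhd y #= `I_mu)].

Definition unique_x_property : Prop :=
  ~ complete /\
  exists u v w,
    [/\ nbhd u v,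
        (sphere 2 u `&` nbhd v) w
      & exists! x,
          (nbhd u `&` sphere 2 v) x /\
          nbhd u `&` nbhd v `&` nbhd w = nbhd u `&` nbhd v `&` nbhd x].

Lemma sphere1 u : sphere 1 u = nbhd u.
Proof.
apply/seteqP; split=> v.
  move=> [[p [xp lp sp]] _].
  by case: p xp lp sp => [|x []] //= /andP[uv _] <-.
move=> uv; split; first by exists [:: v]; rewrite /= andbT.
case=> // _ [p [_ lp sp]].
by case: p lp sp => //= vu _; rewrite /nbhd /= -vu adj_irrefl in uv.
Qed.

Section Induced.
Variables (A : set G) (A_nonempty : A !=set0).

Definition induced_adj : rel (set_type A) := fun a b => adj (val a) (val b).

Lemma induced_sym : symmetric induced_adj.
Proof. by move=> a b; apply: adj_sym. Qed.

Lemma induced_irrefl : irreflexive induced_adj.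
Proof. by move=> a; apply: adj_irrefl. Qed.

Lemma induced_inhabited : inhabited (set_type A).
Proof. by have [x /mem_set Ax] := A_nonempty; exists; exists x. Qed.

Definition induced : sgraph :=
  SGraph induced_sym induced_irrefl induced_inhabited.

End Induced.
End Graph.

Definition isomorphic (G H : sgraph) : Prop :=
  exists2 f : G -> H, bijective f & {mono f : x y / adj x y}.

(* A is non-empty and the subgraph of G induced on A is isomorphic to H *)
Definition induces_copy (G : sgraph) (A : set G) (H : sgraph) : Prop :=
  exists A_nonempty : A !=set0, isomorphic (induced A_nonempty) H.

Definition locally (G S : sgraph) : Prop :=
  forall u : G, induces_copy (nbhd u) S.

Definition every_mu_graph_iso (S D : sgraph) : Prop :=
  forall u w : S, sphere 2 u w -> induces_copy (nbhd u `&` nbhd w) D.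

(* Main.v *)
(* The hypotheses on Delta say that it is a cocktail party graph: every vertex
   has a unique antipode, adjacent to all vertices but itself and that one.
   So whenever [a], [b] are distinct non-adjacent neighbours of a vertex [c] of
   Gamma, the common neighbours of [c], [a], [b] induce a cocktail party graph.
   Let [u], [w] be non-adjacent in [nbhd v], and let [y], [z] be antipodal
   common neighbours of [u], [v], [w].  The required [x] is the antipode of [v]
   among the common neighbours of [u], [y], [z].  The common neighbours of
   [u], [v] and [w], other than [y] and [z], are the common neighbours of
   [u], [v], [y], [z], and so are those of [u], [v] and [x]. *)
Require Import Defs.
From mathcomp Require Import all_boot.
From mathcomp Require Import boolp classical_sets functions cardinality.

Set Implicit Arguments.
Unset Strict Implicit.
Unset Printing Implicit Defensive.

Local Open Scope classical_set_scope.
Local Open Scope card_scope.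

(** No distance is imposed: unlike distance two, this relation passes between a graph and its
    induced subgraphs. *)
Definition antipodal (G : sgraph) (x y : G) : Prop := x <> y /\ ~~ adj x y.

Definition common_nbhd (G : sgraph) (x y z : G) : set G :=
  nbhd x `&` nbhd y `&` nbhd z.

Lemma nbhd_sym (G : sgraph) (x y : G) : nbhd x y = nbhd y x.
Proof. by rewrite /nbhd /= adj_sym. Qed.

Lemma antipodal_sym (G : sgraph) (x y : G) : antipodal x y -> antipodal y x.
Proof. by move=> [xy nxy]; split; [exact: nesym | rewrite adj_sym]. Qed.

Lemma sphere2P (G : sgraph) (x y : G) :
  sphere 2 x y <-> antipodal x y /\ nbhd x `&` nbhd y !=set0.
Proof.
split=> [[[p [xp lp sp]] far]|[[xy nxy] [m [xm ym]]]].
  case: p xp lp sp => [|m [|y' []]] //= /and3P[xm my _] y'y _; subst y'.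
  split; last by exists m; split; rewrite /nbhd //= adj_sym.
  split=> [xy|]; first by apply: (far 0) => //; exists [::].
  by apply/negP => xy; apply: (far 1) => //; exists [:: y]; rewrite /= xy.
split; first by exists [:: m; y]; rewrite /= (adj_sym m) xm ym.
case=> [|[|//]] _ [[|p [|q s]] [//= + lp _]] //.
by rewrite andbT lp; exact/negP.
Qed.

Lemma card_eq_I1 (T : Type) (A : set T) :
  A #= `I_1 -> exists x, A = [set x].
Proof.
move=> /eq_cardSP[x Ax]; rewrite II0 card_eq0 => /eqP Ax0; exists x.
apply/seteqP; split=> [y Ay|_ -> //]; apply: contrapT => yx.
by have : (A `\ x) y by []; rewrite Ax0.
Qed.

(** Maps into [G] itself, rather than into a subtype, can be composed: [Delta] into [Sigma] into
    [Gamma]. *)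
Lemma induces_copy_embedding (G H : sgraph) (A : set G) :
  induces_copy A H ->
  exists h : H -> G, [/\ range h = A, injective h & {mono h : x y / adj x y}].
Proof.
move=> [A0 [f [g fK gK] fadj]]; exists (fun d => val (g d)); split.
- apply/seteqP; split=> [_ [d _ <-]|x Ax]; first exact: set_valP.
  by exists (f (SigSub (mem_set Ax))) => //; rewrite fK.
- by move=> d e /val_inj/(can_inj gK).
- by move=> d e; rewrite -{2}(gK d) -{2}(gK e) fadj.
Qed.

(** Diameter 2 puts every vertex antipodal to [p] at distance exactly 2, where [k_2 = 1] leaves a
    single vertex. *)
Lemma antipode_exists_unique (D : sgraph) :
  has_diameter D 2 -> has_k D 2 1 -> forall p : D, exists! q, antipodal p q.
Proof.
move=> [diam _] k2 p; have [q Sq] := card_eq_I1 (k2 p).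
have /sphere2P[pq _] : sphere 2 p q by rewrite Sq.
exists q; split=> // r [pr npr].
have [[|[|[|i]]] // _] := diam p r.
- by move=> [[s [_ + /size0nil s0]] _]; rewrite s0.
- by rewrite sphere1 => prA; rewrite prA in npr.
- by rewrite Sq => ->.
Qed.

Section Local.
Variables (Gamma Sigma Delta : sgraph) (n k lambda mu : nat).
Hypotheses (Gamma_locally_Sigma : locally Gamma Sigma)
  (Sigma_mu_graphs : every_mu_graph_iso Sigma Delta)
  (Sigma_srg : strongly_regular Sigma n k lambda mu)
  (mu_gt0 : (0 < mu)%N).

Lemma srg_sphere2 (a b : Sigma) : antipodal a b -> sphere 2 a b.
Proof.
case: Sigma_srg => _ _ _ _ mus ab; apply/sphere2P; split=> //.
case: ab => ab nab; have := mus _ _ ab nab.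
by rewrite -(prednK mu_gt0) => /eq_cardSP[m abm _]; exists m.
Qed.

(** Otherwise each vertex is adjacent to all others and has valency [n - 1], against [k < n - 1]. *)
Lemma srg_antipodal : exists a b : Sigma, antipodal a b.
Proof.
case: Sigma_srg => Sv Sk /andP[_ kv] _ _; apply: contrapT => none.
move: Sv; case: n kv => // n'; rewrite subn1 /= => kn /eq_cardSP[a _ an].
have e : [set: Sigma] `\ a = nbhd a.
  apply/seteqP; split=> [b [_ ba]|b ab]; last first.
    by split=> // ba; rewrite ba /nbhd /= adj_irrefl in ab.
  apply: contrapT => /negP nab; apply: none; exists a, b; split=> //.
  exact: nesym.
move: an; rewrite e (card_eql (Sk a)) => /card_eq_II kE.
by rewrite kE ltnn in kn.
Qed.

(** Inside [nbhd c], a copy of [Sigma], the vertices [a] and [b] are at distance two because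
    [mu > 0]; their common neighbours there form a mu-graph. *)
Lemma common_nbhd_embedding (c a b : Gamma) :
  nbhd c a -> nbhd c b -> antipodal a b ->
  exists h : Delta -> Gamma,
    [/\ range h = common_nbhd c a b, injective h & {mono h : x y / adj x y}].
Proof.
move=> ca cb [ab nab].
have [f [fr finj fadj]] := induces_copy_embedding (Gamma_locally_Sigma c).
move: (ca) (cb); rewrite -fr => -[a' _ fa] [b' _ fb].
have ab' : antipodal a' b'.
  by split=> [e|]; [apply: ab; rewrite -fa -fb e | rewrite -fadj fa fb].
have [h [hr hinj hadj]] :=
  induces_copy_embedding (Sigma_mu_graphs (srg_sphere2 ab')).
exists (f \o h); split; last 2 first.
- exact: inj_comp.
- by move=> p q /=; rewrite fadj hadj.
apply/seteqP; split=> [_ [d _ <-]|x [[cx ax] bx]].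
  have : range h (h d) by exists d.
  rewrite hr => -[ha hb]; have : range f (f (h d)) by exists (h d).
  by rewrite fr => cd; split; [split|] => //=; rewrite /nbhd /= -?fa -?fb fadj.
move: cx; rewrite -fr => -[x' _ fx].
have : range h x'.
  by rewrite hr; split; rewrite /nbhd /= -fadj ?fa ?fb fx.
by move=> [d _ hd]; exists d => //=; rewrite hd.
Qed.

Hypotheses (Delta_diam : has_diameter Delta 2) (Delta_k2 : has_k Delta 2 1).

Lemma common_nbhd_antipode (c a b p : Gamma) :
  nbhd c a -> nbhd c b -> antipodal a b -> common_nbhd c a b p ->
  exists! q, common_nbhd c a b q /\ antipodal p q.
Proof.
move=> ca cb ab; have [h [hr hinj hadj]] := common_nbhd_embedding ca cb ab.
have hanti d e : antipodal (h d) (h e) <-> antipodal d e.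
  rewrite /antipodal hadj; split=> -[de nde]; split=> // e'.
    by apply: de; rewrite e'.
  by apply/de/hinj.
rewrite -hr => -[d _ <-].
have [e [de euniq]] := antipode_exists_unique Delta_diam Delta_k2 d.
exists (h e); split; first by split; [exists e | apply/hanti].
by move=> _ [[e' _ <-] /hanti/euniq ->].
Qed.

Lemma common_nbhd_nonempty (c a b : Gamma) :
  nbhd c a -> nbhd c b -> antipodal a b -> common_nbhd c a b !=set0.
Proof.
move=> ca cb ab; have [h [<- _ _]] := common_nbhd_embedding ca cb ab.
by have [d] := vertex_inhabited Delta; exists (h d), d.
Qed.

(** If [r] were not adjacent to [p], it would be a second antipode of [p] besides [q]. *)
Lemma common_nbhd_adj (c a b p q r : Gamma) :
  nbhd c a -> nbhd c b -> antipodal a b ->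
  common_nbhd c a b p -> common_nbhd c a b q -> common_nbhd c a b r ->
  antipodal p q -> r <> p -> r <> q -> adj p r.
Proof.
move=> ca cb ab Mp Mq Mr pq rp rq; apply: contrapT => /negP npr.
have [q' [_ uniq]] := common_nbhd_antipode ca cb ab Mp.
have qr : q' = r by apply: uniq; do 2!split=> //; exact: nesym.
by apply: rq; rewrite -qr; apply: uniq.
Qed.

(** A vertex [p] of the left side other than [y], [z] is adjacent to both, so it lies in
    [common_nbhd t y z]. There [b] and [s] are antipodes, and [p] differs from both, hence is
    adjacent to [b]. *)
Lemma common_nbhd_subset (s t a b y z : Gamma) :
  nbhd s t -> nbhd s a -> antipodal t a -> nbhd t b -> antipodal b s ->
  common_nbhd s t a y -> common_nbhd s t a z -> antipodal y z ->
  nbhd b y -> nbhd b z -> common_nbhd s t a `<=` nbhd b.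
Proof.
move=> st sa ta tb bs My Mz yz yb zb p Mp.
have [->//|py] := pselect (p = y); have [->//|pz] := pselect (p = z).
have yp : adj y p := common_nbhd_adj st sa ta My Mz Mp yz py pz.
have zp : adj z p := common_nbhd_adj st sa ta Mz My Mp (antipodal_sym yz) pz py.
case: My Mz Mp => -[sy ty] _ [[sz tz] _] [[sp tp] _].
have sub m : nbhd t m -> nbhd m y -> nbhd m z -> common_nbhd t y z m.
  by move=> tm my mz; split; [split|]; rewrite // nbhd_sym.
apply: (common_nbhd_adj ty tz yz (q := s)) => //.
- exact: sub.
- by apply: sub => //; rewrite nbhd_sym.
- by move=> pb; case: bs => _ /negP; rewrite -pb adj_sym.
- by move=> ps; rewrite ps /nbhd /= adj_irrefl in sp.
Qed.

Lemma unique_antipode_same_common_nbhd (u v w : Gamma) :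
  nbhd v u -> nbhd v w -> antipodal u w ->
  exists! x, (nbhd u `&` sphere 2 v) x /\
    nbhd u `&` nbhd v `&` nbhd w = nbhd u `&` nbhd v `&` nbhd x.
Proof.
move=> vu vw uw; have uv : nbhd u v by rewrite nbhd_sym.
have [y My] := common_nbhd_nonempty vu vw uw.
have [z [[Mz yz] _]] := common_nbhd_antipode vu vw uw My.
case: (My) (Mz) => -[vy uy] wy [[vz uz] wz].
have Mv : common_nbhd u y z v by split; [split|]; rewrite // nbhd_sym.
have [x [[[[ux yx] zx] vx] uniq]] := common_nbhd_antipode uy uz yz Mv.
rewrite nbhd_sym in yx; rewrite nbhd_sym in zx.
exists x; split.
  split; first by split; last by apply/sphere2P; split; last by
    exists u; split; rewrite // nbhd_sym.
  have uwx := common_nbhd_subset vu vw uw ux (antipodal_sym vx) My Mz yz yx zx.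
  (* The reverse inclusion exchanges [u] with [v] and [w] with [x]. *)
  have vxw : common_nbhd u v x `<=` nbhd w.
    apply: (common_nbhd_subset uv ux vx vw _ _ _ yz wy wz) => //.
    exact: antipodal_sym.
  apply/seteqP; split=> p Mp; have [[up vp] _] := Mp; split=> //.
    by apply: uwx; case: Mp.
  exact: vxw.
(* As [y] and [z] lie in the left side of [e], they are adjacent to [x'], which is thus an antipode
   of [v] in [common_nbhd u y z]. *)
move=> x' [[ux' /sphere2P[vx' _]] e]; apply: uniq; split=> //.
have xE m : nbhd u m -> nbhd v m -> nbhd w m -> nbhd m x'.
  move=> um vm wm; rewrite nbhd_sym.
  by have : (nbhd u `&` nbhd v `&` nbhd w) m by []; rewrite e => -[].
by split; [split|]; rewrite //; apply: xE.
Qed.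

End Local.

Theorem lemma4p2 (Gamma Sigma Delta : sgraph)
  (v k lambda mu : nat)
  (Gamma_locally_Sigma : locally Gamma Sigma)
  (Sigma_mu_graphs : every_mu_graph_iso Sigma Delta)
  (Sigma_srg : strongly_regular Sigma v k lambda mu)
  (mu_gt0 : (0 < mu)%N)
  (Delta_regular : regular Delta)
  (Delta_diam : has_diameter Delta 2)
  (Delta_k2 : has_k Delta 2 1) :
  unique_x_property Gamma.
Proof.
have [a [b [ab nab]]] := srg_antipodal Sigma_srg.
have [v0] := vertex_inhabited Gamma.
have [f [fr finj fadj]] := induces_copy_embedding (Gamma_locally_Sigma v0).
have fP d : nbhd v0 (f d) by rewrite -fr; exists d.
(* This pair inside [nbhd v0] both refutes completeness and serves as [u] and [w], with [v0] as
   [v]. *)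
have uw : antipodal (f a) (f b).
  by split; [move=> /finj | rewrite fadj].
have [fab nfab] := uw; split=> [G_complete|].
  by move/negP: nfab; apply; exact: G_complete.
exists (f a), v0, (f b); split.
- by rewrite nbhd_sym.
- split=> //; apply/sphere2P; split=> //.
  by exists v0; split; rewrite nbhd_sym.
- exact: (unique_antipode_same_common_nbhd Gamma_locally_Sigma
    Sigma_mu_graphs Sigma_srg mu_gt0 Delta_diam Delta_k2).
Qed.
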